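(* Let $n=6$ or $n\geq 8$ be an integer. The minimum coprime number of the square $P_n^2$ of the path is given by $$\mathfrak{pr}(P_n^2)=\begin{cases} 4k-1 & \text{if } n=3k \text{ or } n=3k+1,\\ 4k+1 & \text{if } n=3k+2, \end{cases}$$ where $k$ is an integer.
   Context: $P_n$ is the path on $n$ vertices. The $k$-th power $G^k$ of a graph $G$ has the same vertex set as $G$, with an edge between distinct $u,v$ whenever the distance $d(u,v)$ in $G$ is at most $k$. All graphs are finite and simple. A coprime labeling of a graph $G$ of order $N$ is an assignment of distinct labels from $\{1,\ldots,M\}$, for some integer $M\ge N$, to the vertices of $G$ such that adjacent vertices receive relatively prime labels. The minimum coprime number $\mathfrak{pr}(G)$ is the minimum value $M$ for which such a labeling exists. *)

(* Defs.v *)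
From mathcomp Require Import all_boot.

Set Implicit Arguments.
Unset Strict Implicit.
Unset Printing Implicit Defensive.

Record sgraph (T : finType) := SGraph {
  adj :> rel T;
  adj_sym : symmetric adj;
  adj_irrefl : irreflexive adj
}.

Section Distance.
Variables (T : finType) (G : sgraph T).

Definition has_walk (l : nat) (u v : T) : bool :=
  [exists p : l.-tuple T, path G u p && (last u p == v)].

(* [None] stands for infinity. The search stops at [#|T|]: a shortest walk
   repeats no vertex, so it has fewer than [#|T|] edges. *)
Definition dist (u v : T) : option nat :=
  if connect G u v
  then Some (find (fun l => has_walk l u v) (iota 0 #|T|))
  else None.

Lemma has_walk_sym l : symmetric (has_walk l).
Proof.
suff H u v : has_walk l u v -> has_walk l v u by move=> u v; apply/idP/idP; exact: H.
case/existsP=> p /andP[Gp /eqP <-].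
have sz : size (rev (belast u p)) == l by rewrite size_rev size_belast size_tuple.
apply/existsP; exists (Tuple sz) => /=.
rewrite rev_path (eq_path (e' := G)); last by move=> x y; rewrite adj_sym.
by rewrite Gp; case: (tval p) => //= x q; rewrite rev_cons last_rcons eqxx.
Qed.

Lemma dist_sym u v : dist u v = dist v u.
Proof.
rewrite /dist (sym_connect_sym (@adj_sym _ G)).
rewrite (@eq_find _ _ (fun l => has_walk l v u)) //.
by move=> l /=; rewrite has_walk_sym.
Qed.

Lemma distP u v d :
  dist u v = Some d <->
  has_walk d u v /\ (forall l, has_walk l u v -> d <= l).
Proof.
set a := fun l => has_walk l u v.
have walk_connect l : a l -> connect G u v.
  by case/existsP=> p /andP[Gp /eqP <-]; apply/connectP; exists p.
have short : connect G u v -> has a (iota 0 #|T|).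
  case/connectP=> p Gp; case: (shortenP Gp) => q Gq Uq _ Ev.
  apply/hasP; exists (size q).
    by rewrite mem_iota /= add0n -[(size q).+1]/(size (u :: q)) -(card_uniqP Uq) max_card.
  by apply/existsP; exists (in_tuple q); rewrite Gq Ev eqxx.
have least : connect G u v ->
    a (find a (iota 0 #|T|)) /\ forall l, a l -> find a (iota 0 #|T|) <= l.
  move/short=> ha; have lt_f : find a (iota 0 #|T|) < #|T|.
    by rewrite -[X in _ < X](size_iota 0) -has_find.
  split; first by move/(nth_find 0): ha; rewrite nth_iota // add0n.
  move=> l al; rewrite leqNgt; apply/negP=> lt_l.
  have := before_find 0 lt_l; rewrite nth_iota ?(ltn_trans lt_l) // add0n.
  by rewrite al.
rewrite /dist; split=> [|[ad mind]].
  by case: ifP => // /least H [<-].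
have cuv := walk_connect _ ad; rewrite cuv; congr Some.
by have [af minf] := least cuv; apply/eqP; rewrite eqn_leq minf //= mind.
Qed.

End Distance.

Section Power.
Variables (T : finType) (G : sgraph T) (k : nat).

Definition power_rel : rel T := fun u v =>
  (u != v) && (if dist G u v is Some d then d <= k else false).

Lemma power_sym : symmetric power_rel.
Proof. by move=> u v; rewrite /power_rel dist_sym eq_sym. Qed.

Lemma power_irrefl : irreflexive power_rel.
Proof. by move=> u; rewrite /power_rel eqxx. Qed.

Definition power_graph : sgraph T := SGraph power_sym power_irrefl.
End Power.

Section Path.
Variable n : nat.

Definition path_rel : rel 'I_n := fun i j => (i.+1 == j) || (j.+1 == i).

Lemma path_sym : symmetric path_rel.
Proof. by move=> i j; rewrite /path_rel orbC. Qed.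

Lemma path_irrefl : irreflexive path_rel.
Proof. by move=> i; rewrite /path_rel orbb gtn_eqF. Qed.

Definition path_graph : sgraph 'I_n := SGraph path_sym path_irrefl.
End Path.

Section CoprimeLabeling.
Variables (T : finType) (G : sgraph T).

Definition coprime_labeling (M : nat) (f : T -> nat) : bool :=
  [&& #|T| <= M, injectiveb f, [forall v, 1 <= f v <= M]
    & [forall u, forall v, G u v ==> coprime (f u) (f v)]].

Definition has_coprime_labeling (M : nat) : bool :=
  [exists f : {ffun T -> 'I_M.+1}, coprime_labeling M (fun v => f v)].

Lemma has_coprime_labelingP M :
  reflect (exists f : T -> nat, coprime_labeling M f) (has_coprime_labeling M).
Proof.
apply: (iffP existsP) => [[f Hf]|[f Hf]]; first by exists (fun v => nat_of_ord (f v)).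
have [sz /injectiveP inj_f /forallP bnd /forallP cop] := and4P Hf.
have E v : [ffun v => inord (f v) : 'I_M.+1] v = f v :> nat.
  by rewrite ffunE inordK // ltnS; case/andP: (bnd v).
exists [ffun v => inord (f v)]; apply/and4P; split=> //.
- by apply/injectiveP => u v; rewrite !E; apply: inj_f.
- by apply/forallP => v; rewrite E.
by apply/forallP=> u; apply/forallP=> v; rewrite !E; apply: (forallP (cop u)).
Qed.

(* Distinct primes as labels. *)
Lemma ex_coprime_labeling : exists M, has_coprime_labeling M.
Proof.
have [p p_prime p_lt] : exists2 p : nat -> nat,
    forall i, prime (p i) & forall i, p i < p i.+1.
  pose next m := s2val (prime_above m).
  have next_prime m : prime (next m) by rewrite /next; case: (prime_above m).
  have next_gt m : m < next m by rewrite /next; case: (prime_above m).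
  by exists (fun i => iter i.+1 next 0) => i; rewrite iterS.
have p_mono : {mono p : i j / i <= j} by apply: leq_mono; apply: homo_ltn => //; exact: ltn_trans.
have p_inj : injective p := incn_inj p_mono.
pose f (v : T) := p (enum_rank v).
have f_inj : injective f by move=> u v /p_inj /val_inj /enum_rank_inj.
exists (#|T| + p #|T|); apply/has_coprime_labelingP; exists f; apply/and4P; split.
- exact: leq_addr.
- exact/injectiveP.
- apply/forallP=> v; rewrite (prime_gt0 (p_prime _)) /=.
  by apply: leq_trans (leq_addl _ _); rewrite p_mono ltnW.
apply/forallP=> u; apply/forallP=> v; apply/implyP=> Guv.
rewrite prime_coprime ?dvdn_prime2 ?p_prime // (inj_eq f_inj).
by apply: contraTneq Guv => ->; rewrite adj_irrefl.
Qed.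

Definition min_coprime_number : nat := ex_minn ex_coprime_labeling.

End CoprimeLabeling.

(* Main.v *)
Require Import Defs.
From mathcomp Require Import all_boot.
From mathcomp Require Import zify.

Set Implicit Arguments.
Unset Strict Implicit.
Unset Printing Implicit Defensive.

(** In the square of a path any three consecutive vertices are mutually adjacent,
    so a coprime labeling is an injective sequence of positive integers in which
    every window of three terms is pairwise coprime.

    Lower bound ([leq_coprime_label]).  A window of three contains at most one
    even label, so at most [(n + 2) %/ 3] labels are even.  All the others are
    distinct odd numbers in [1..M], of which there are [uphalf M].  Hence
    [n <= (n + 2) %/ 3 + uphalf M], that is [2 * (2 * n %/ 3) - 1 <= M].

    Upper bound ([min_coprime_square_path]).  Equality forces every odd number up to
    [M] to be used.  List them in pairs (3, 5), (7, 9), (11, 13), ... with one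
    even number before each pair.  Consecutive odd numbers are coprime, so only
    the even numbers need care: the one between (4j-1, 4j+1) and (4j+3, 4j+5)
    must be coprime to these four.  The midpoint 4j+2 differs from them by 1 or
    3, and works unless 3 divides it; in that case 4j+4 or 4j differ from them
    by 1, 3 or 5, are not multiples of 3, and are not both multiples of 5
    ([coprime_sep]).  These choices leave 4 free, which is coprime to every odd
    number, while 1 is coprime to everything; so after [m] groups of three the
    sequence can be closed by 4, 1, 4m+3, 4m+2.  Its prefixes of lengths 3m+2,
    3m+3 and 3m+4 have maxima 4m+1, 4m+3 and 4m+3, which meet the lower bound in
    every residue class modulo 3. *)

(** * Powers of a path *)

Lemma path_graph_walk_le n (u : 'I_n) (p : seq 'I_n) :
  path (path_graph n) u p ->
  (u <= last u p + size p) && (last u p <= u + size p).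
Proof.
elim: p u => [|w p IH] u /=; first by lia.
by case/andP=> uw /IH; move: uw; rewrite /path_rel; lia.
Qed.

Lemma path_graph_has_walk n d (u v : 'I_n) :
  v = u + d :> nat -> has_walk (path_graph n) d u v.
Proof.
move=> Ev; apply/existsP.
suff [p /eqP sz Hp]: exists2 p : seq 'I_n,
    size p = d & path (path_graph n) u p && (last u p == v).
  by exists (Tuple sz).
elim: d u Ev => [|d IH] u Ev.
  by exists [::] => //=; apply/eqP/val_inj => /=; lia.
have lt_u : u.+1 < n by have := ltn_ord v; lia.
have [|p sz /andP[Hp Hl]] := IH (Ordinal lt_u); first by rewrite /=; lia.
by exists (Ordinal lt_u :: p); rewrite /= ?sz // Hp Hl /path_rel eqxx.
Qed.

Lemma has_walk_dist_le (T : finType) (G : sgraph T) l (u v : T) :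
  has_walk G l u v -> exists2 d, dist G u v = Some d & d <= l.
Proof.
move=> Hl; have Hex : exists l, has_walk G l u v by exists l.
exists (ex_minn Hex); last by case: ex_minnP => d _; apply.
by apply/distP; case: ex_minnP.
Qed.

Lemma power_path_adjE n k (u v : 'I_n) :
  power_graph (path_graph n) k u v =
  [&& u != v, u <= v + k & v <= u + k].
Proof.
rewrite /= /power_rel; case: eqP => //= _.
apply/idP/idP => [|near].
  case E: dist => [d|] // le_dk; have [/existsP[p] ] := (distP _ _ _ _).1 E.
  by case/andP=> /path_graph_walk_le + /eqP Ep _; rewrite Ep size_tuple; lia.
suff [l Hl le_lk] : exists2 l, has_walk (path_graph n) l u v & l <= k.
  have [d -> le_dl] := has_walk_dist_le Hl; exact: leq_trans le_dl le_lk.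
have [le_uv|lt_vu] := leqP u v.
  by exists (v - u); [apply: path_graph_has_walk|]; lia.
by exists (u - v); [rewrite has_walk_sym; apply: path_graph_has_walk|]; lia.
Qed.

(** * The lower bound *)

Lemma leq_card_dom_nat (T : finType) (A : {pred T}) N (h : T -> nat) :
  {in A &, injective h} -> {in A, forall x, h x < N} -> #|A| <= N.
Proof.
move=> h_inj h_lt; have [->|/card_gt0P[x0 Ax0]] := posnP #|A|; first by [].
have {x0 Ax0} N_gt0 : 0 < N := leq_ltn_trans (leq0n _) (h_lt _ Ax0).
case: N N_gt0 h_lt => // N _ h_lt.
rewrite -[N.+1]card_ord -(@card_in_image _ _ (fun x => inord (h x) : 'I_N.+1)).
  exact: max_card.
by move=> x y Ax Ay /(congr1 val) /=; rewrite !inordK ?h_lt //; apply: h_inj.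
Qed.

(** The blocks [{3i, 3i+1, 3i+2}] are cliques, so each has at most one even
    label; halving separates the odd labels. *)
Lemma leq_coprime_label n M :
  has_coprime_labeling (power_graph (path_graph n) 2) M ->
  n <= (n + 2) %/ 3 + uphalf M.
Proof.
case/has_coprime_labelingP=> f /and4P[_ /injectiveP f_inj /forallP bnd /forallP cop].
rewrite -[X in X <= _](card_ord n) -(cardC [pred i | ~~ odd (f i)]) leq_add //.
  apply: (@leq_card_dom_nat _ _ _ (fun i : 'I_n => i %/ 3)) => [i j|i _] /=.
    rewrite !inE => ev_i ev_j same; apply/eqP/negPn/negP=> neq.
    have := implyP (forallP (cop i) j); rewrite power_path_adjE neq /=.
    have close : (i <= j + 2) && (j <= i + 2) by lia.
    move/(_ close) => /eqP gcd1.
    have : 2 %| gcdn (f i) (f j) by rewrite dvdn_gcd !dvdn2 ev_i.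
    by rewrite gcd1.
  by have := ltn_ord i; lia.
apply: (@leq_card_dom_nat _ _ _ (fun i : 'I_n => (f i)./2)) => [i j|i] /=.
  rewrite !inE !negbK => odd_i odd_j half_eq; apply: f_inj.
  by rewrite -(odd_double_half (f i)) -(odd_double_half (f j)) half_eq odd_i odd_j.
by rewrite !inE negbK => odd_i; have := bnd i; lia.
Qed.

(** * The optimal labeling *)

(** The even number that separates the pairs (4j-1, 4j+1) and (4j+3, 4j+5). *)
Definition sep j :=
  if j %% 3 != 1 then 4 * j + 2
  else if 5 %| j.+1 then 4 * j
  else 4 * j + 4.

Lemma sep_even j : ~~ odd (sep j).
Proof. by rewrite /sep; do 2?case: ifP => _; lia. Qed.

Lemma sep_bounds j : 4 * j <= sep j <= 4 * j + 4.
Proof. by rewrite /sep; do 2?case: ifP => _; lia. Qed.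

Lemma sep_gt0 j : 0 < sep j.
Proof. by rewrite /sep; do 2?case: ifP => ?; lia. Qed.

(** Each value is recognised modulo 4, and the multiples of 4 come from indices
    that are at least 3 apart. *)
Lemma sep_inj : injective sep.
Proof. by move=> i j; rewrite /sep; do 4?case: ifP => ?; lia. Qed.

(** The value 4 would need [j = 1], where [sep 1 = 8]. *)
Lemma sep_neq4 j : sep j != 4.
Proof. by rewrite /sep; do 2?case: ifP => ?; lia. Qed.

Lemma coprime_prime_dist p a b :
  prime p -> ~~ (p %| a) -> b = a + p \/ a = b + p -> coprime a b.
Proof.
move=> pr_p + E; case: E => ->.
  by rewrite /coprime gcdnDl -/(coprime a p) coprime_sym prime_coprime.
by rewrite dvdn_addl // coprime_sym /coprime gcdnDl -/(coprime b p) coprime_sym prime_coprime.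
Qed.

Lemma coprime_dist1 a b : (b = a.+1) \/ (a = b.+1) -> coprime a b.
Proof. by case=> ->; [apply: coprimenS | rewrite coprime_sym; apply: coprimenS]. Qed.

(** An odd [o] from 4j-1 to 4j+5 is at distance 1, 3 or 5 from [sep j].  The
    definition of [sep] avoids multiples of 3 altogether, and multiples of 5
    whenever one of its neighbours is at distance 5. *)
Lemma coprime_sep j o : odd o -> 4 * j <= o.+1 -> o <= 4 * j + 5 -> coprime (sep j) o.
Proof.
move=> odd_o lo hi.
have three : ~~ (3 %| sep j) by rewrite /sep; do 2?case: ifP => ?; lia.
have five : sep j = o + 5 \/ o = sep j + 5 -> ~~ (5 %| sep j).
  by rewrite /sep; do 2?case: ifP => ?; lia.
have [d1|d1] : (o = (sep j).+1 \/ sep j = o.+1) \/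
    (o = sep j + 3 \/ sep j = o + 3) \/ (o = sep j + 5 \/ sep j = o + 5).
- by have := sep_even j; have := sep_bounds j; lia.
- exact: coprime_dist1.
case: d1 => d; first exact: coprime_prime_dist three d.
by apply: (@coprime_prime_dist 5) => //; apply: five; lia.
Qed.

Definition block_label p :=
  if p %% 3 == 0 then sep (p %/ 3) else 4 * (p %/ 3) + (p %% 3).*2 + 1.

(** In the closing 4, 1, 4m+3, 4m+2 the label 1 shields the two large labels from
    the blocks: 4m+3 is within distance 2 only of 4, 1 and 4m+2. *)
Definition label m p :=
  if p < 3 * m then block_label p
  else nth 0 [:: 4; 1; 4 * m + 3; 4 * m + 2] (p - 3 * m).

Lemma block_label_inj : injective block_label.
Proof.
move=> p q; rewrite /block_label.
have := sep_even (p %/ 3); have := sep_even (q %/ 3).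
case: ifP => p0; case: ifP => q0 => ? ?; [move/sep_inj|..]; lia.
Qed.

Lemma block_label_bounds m p : p < 3 * m -> 1 < block_label p <= 4 * m + 1.
Proof.
move=> lt_pm; rewrite /block_label; have := sep_bounds (p %/ 3).
have := sep_gt0 (p %/ 3); have := sep_even (p %/ 3).
by case: ifP => p0; lia.
Qed.

Lemma block_label_neq4 p : block_label p != 4.
Proof. by rewrite /block_label; case: ifP => _; [apply: sep_neq4 | lia]. Qed.

Lemma coprime_block_label p q :
  p < q -> q <= p + 2 -> coprime (block_label p) (block_label q).
Proof.
move=> lt_pq le_qp; rewrite /block_label.
case: ifP => p0; case: ifP => q0; first lia.
- by apply: coprime_sep; lia.
- by rewrite coprime_sym; apply: coprime_sep; lia.
by apply: (@coprime_prime_dist 2) => //; lia.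
Qed.

Variant label_spec m p : nat -> Type :=
| LabelBlock of p < 3 * m : label_spec m p (block_label p)
| Label4 of p = 3 * m : label_spec m p 4
| Label1 of p = 3 * m + 1 : label_spec m p 1
| LabelOdd of p = 3 * m + 2 : label_spec m p (4 * m + 3)
| LabelEven of p = 3 * m + 3 : label_spec m p (4 * m + 2).

Lemma labelP m p : p < 3 * m + 4 -> label_spec m p (label m p).
Proof.
rewrite /label => lt_p; case: ltnP => [?|le_p]; first by constructor.
rewrite -(subnKC le_p) in lt_p *; move: (p - 3 * m) lt_p => r.
rewrite addKn ltn_add2l => lt_r.
by case: r lt_r => [|[|[|[|r]]]] //= _; constructor; rewrite ?addn0.
Qed.

Lemma label_inj m p q :
  p < 3 * m + 4 -> q < 3 * m + 4 -> label m p = label m q -> p = q.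
Proof.
move=> lt_p lt_q; have := block_label_neq4 p; have := block_label_neq4 q.
case: (labelP lt_p) => [/[dup] ltp /block_label_bounds bp|Ep|Ep|Ep|Ep];
  case: (labelP lt_q) => [/[dup] ltq /block_label_bounds bq|Eq|Eq|Eq|Eq]; try lia.
by move=> _ _ /block_label_inj.
Qed.

Lemma coprime_label m p q :
  p < q -> q <= p + 2 -> q < 3 * m + 4 -> coprime (label m p) (label m q).
Proof.
move=> lt_pq le_qp lt_q; have lt_p := ltn_trans lt_pq lt_q.
case: (labelP lt_p) => [ltp|Ep|Ep|Ep|Ep]; case: (labelP lt_q) => [ltq|Eq|Eq|Eq|Eq];
  rewrite ?coprimen1 ?coprime1n //; try lia.
- exact: coprime_block_label.
(* In this case and the next, 4 is read as [2 ^ 2]. *)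
- have odd_p : odd (block_label p) by rewrite /block_label; case: ifP; lia.
  by rewrite (@coprime_pexpr 2 _ 2) // coprimen2.
- by rewrite (@coprime_pexpl 2 2) // coprime2n; lia.
by apply: coprime_dist1; lia.
Qed.

Lemma label_gt0 m p : p < 3 * m + 4 -> 0 < label m p.
Proof.
by move=> lt_p; case: (labelP lt_p) => [/block_label_bounds||||]; lia.
Qed.

Lemma has_coprime_labeling_label n m M :
  n <= 3 * m + 4 -> n <= M -> (forall p, p < n -> label m p <= M) ->
  has_coprime_labeling (power_graph (path_graph n) 2) M.
Proof.
move=> le_n le_nM le_M; have in_dom (i : 'I_n) : i < 3 * m + 4.
  exact: leq_trans (ltn_ord i) le_n.
apply/has_coprime_labelingP; exists (fun i : 'I_n => label m i).
apply/and4P; split; first by rewrite card_ord.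
- by apply/injectiveP=> i j /(label_inj (in_dom i) (in_dom j)) /val_inj.
- by apply/forallP=> i; rewrite label_gt0 ?le_M.
apply/forallP=> i; apply/forallP=> j; apply/implyP; rewrite power_path_adjE.
case/and3P=> neq le_ij le_ji; have [lt_ij|lt_ji|/val_inj E] := ltngtP i j.
- exact: coprime_label.
- by rewrite coprime_sym; apply: coprime_label.
by rewrite E eqxx in neq.
Qed.

(** Here [2 * n %/ 3] equals [n - (n + 2) %/ 3], the least possible number of odd
    labels.  On the other side [label] is cut at [n = 3m+2], [3m+3] or [3m+4]; in
    the last case the extra label is 4m+2, below the maximum 4m+3. *)
Lemma min_coprime_square_path n :
  5 <= n ->
  min_coprime_number (power_graph (path_graph n) 2) = (2 * n %/ 3).*2 - 1.
Proof.
move=> n_ge5; rewrite /min_coprime_number.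
case: ex_minnP => M /leq_coprime_label lower minM.
apply/eqP; rewrite eqn_leq; apply/andP; split; last by lia.
apply: minM; apply: (@has_coprime_labeling_label _ ((n - 2) %/ 3)); [lia..|].
move=> p lt_p; have lt_p' : p < 3 * ((n - 2) %/ 3) + 4 by lia.
by case: (labelP lt_p') => [/block_label_bounds||||]; lia.
Qed.

Theorem theorem10 (n : nat) (hn : n = 6 \/ 8 <= n) (k : nat) :
  (n = 3 * k \/ n = 3 * k + 1 ->
     min_coprime_number (power_graph (path_graph n) 2) = 4 * k - 1) /\
  (n = 3 * k + 2 ->
     min_coprime_number (power_graph (path_graph n) 2) = 4 * k + 1).
Proof. by split=> En; rewrite min_coprime_square_path; lia. Qed.
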